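(* Given an $\mathcal{FF}^{PD}_g$-space of dimension $N=3$ and a fixed tangent space $T_xM$. In terms of the Finsleroid coordinates $z^1=K$, $z^2=\phi$, $z^3=\chi$ (which extend the spherical coordinates of the tangent spaces of a three-dimensional Riemannian space), the metric is of the diagonal representation $$(ds)^2=(dz^1)^2+(z^1)^2\Bigl[(d\chi)^2+\frac1{h^2}\sin^2(h\chi)\,(d\phi)^2\Bigr],$$ so that the induced metric on the indicatrix ($z^1=1$) is diagonal. The metric is of the conformally flat type: $$(ds)^2=\varkappa^2\,(ds)^2\big|_{\text{Euclidean}}\qquad\text{with}\qquad \varkappa=\frac1hK^{1-h},$$ where $(ds)^2|_{\text{Euclidean}}$ is a Euclidean (flat) metric.
   Context: $M$ is a 3-dimensional manifold with Riemannian metric $a_{ij}(x)$ and a 1-form $b=b_i(x)y^i$ of unit length, $a_{ij}b^ib^j=1$, $b^i=a^{ij}b_j$. Let $g=g(x)$ be a scalar with $-2<g<2$ and $h=\sqrt{1-g^2/4}$. Put $q=\sqrt{(a_{mn}-b_mb_n)y^my^n}$, $A=b+\frac12gq$, $B=b^2+gbq+q^2$, $f=\arccos(A/\sqrt B)\in[0,\pi]$, and $\chi=f/h$ (azimuthal angle). The $\mathcal{FF}^{PD}_g$-Finsleroid metric function is $K(x,y)=\sqrt B\,e^{-\frac12g\chi}$, with metric tensor $g_{ij}=\frac12\partial^2K^2/\partial y^i\partial y^j$. Fix $x\in M$ and an orthonormal frame of $a_{ij}(x)$ in $T_xM$ whose third vector is $b^i(x)$; let $R^1,R^2,R^3$ be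 the frame components of $y\in T_xM$, so $R^3=b$, $q=\sqrt{(R^1)^2+(R^2)^2}$. The polar angle $\phi$ is defined by $R^1=q\cos\phi$, $R^2=q\sin\phi$. $(ds)^2=g_{rs}(R)\,dR^rdR^s$ is the squared linear element of the Finsleroid metric tensor in the fixed tangent space (away from the axis $q=0$). The indicatrix is $\{K=1\}$ with the metric induced from $(ds)^2$. *)

(* Defs.v *)
From HB Require Import structures.
From mathcomp Require Import all_boot all_order all_algebra.
From mathcomp Require Import all_classical all_reals all_analysis.

Set Implicit Arguments.
Unset Strict Implicit.
Unset Printing Implicit Defensive.

Import Order.TTheory GRing.Theory Num.Theory.
Import numFieldNormedType.Exports.

Local Open Scope classical_set_scope.
Local Open Scope ring_scope.

(* [mpoint] is the underlying set of M.  At each x the fields are the components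
   a_ij(x), b_i(x) in some basis of T_xM (the coordinate basis of a chart, for
   instance), which identifies T_xM with 'rV_N, y being the row (y^1 .. y^N).
   No regularity in x is required: every object below lives in one fixed
   tangent space. *)
Record FFPD_space (R : realType) (N : nat) := FFPDSpace {
  mpoint : Type;
  metric_a : mpoint -> 'M[R]_N;
  form_b : mpoint -> 'rV[R]_N;
  charge_g : mpoint -> R;
  metric_a_sym : forall x, (metric_a x)^T = metric_a x;
  metric_a_posdef : forall x (v : 'rV[R]_N),
    v != 0 -> 0 < (v *m metric_a x *m v^T) 0 0;
  (* a_ij b^i b^j = a^ij b_i b_j = 1 *)
  form_b_unit : forall x,
    (form_b x *m invmx (metric_a x) *m (form_b x)^T) 0 0 = 1;
  charge_g_range : forall x, -2 < charge_g x < 2 }.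

Section Finsleroid.
Variables (R : realType) (N : nat) (S : FFPD_space R N) (x : mpoint S).
Implicit Types y : 'rV[R]_N.

Local Notation a := (metric_a x).
Local Notation g := (charge_g x).

Definition b_up : 'rV[R]_N :=
  \row_i \sum_j invmx a i j * form_b x 0 j.

Definition fb y : R := \sum_i form_b x 0 i * y 0 i.

Definition fq y : R :=
  Num.sqrt (\sum_m \sum_n
    (a m n - form_b x 0 m * form_b x 0 n) * y 0 m * y 0 n).

Definition hpar : R := Num.sqrt (1 - g ^+ 2 / 4).

Definition fA y : R := fb y + 2^-1 * g * fq y.

Definition fB y : R := fb y ^+ 2 + g * fb y * fq y + fq y ^+ 2.

Definition ff y : R := acos (fA y / Num.sqrt (fB y)).

Definition fchi y : R := ff y / hpar.

Definition fK y : R := Num.sqrt (fB y) * expR (- (2^-1 * g * fchi y)).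

End Finsleroid.

Definition partial (R : realType) (n : nat) (i : 'I_n) (F : 'rV[R]_n -> R)
  : 'rV[R]_n -> R := fun y => 'D_(delta_mx 0 i) F y.

Definition metric_tensor (R : realType) (N : nat) (S : FFPD_space R N)
    (x : mpoint S) (y : 'rV[R]_N) : 'M[R]_N :=
  \matrix_(i, j) (2^-1 * partial i (partial j (fun y => fK x y ^+ 2)) y).

Fixpoint Ck_on (R : realType) (n : nat) (k : nat) (U : set 'rV[R]_n)
    (F : 'rV[R]_n -> R) : Prop :=
  if k is k'.+1 then
    (forall y, U y -> differentiable F y) /\
    (forall i : 'I_n, Ck_on k' U (partial i F))
  else forall y, U y -> {for y, continuous F}.

Definition smooth_on (R : realType) (n : nat) (U : set 'rV[R]_n)
    (F : 'rV[R]_n -> R) : Prop := forall k, Ck_on k U F.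

Definition coordinates_on (R : realType) (n : nat) (U : set 'rV[R]_n)
    (z : 'I_n -> 'rV[R]_n -> R) : Prop :=
  [/\ forall k, smooth_on U (z k),
      forall r s, U r -> U s -> (forall k, z k r = z k s) -> r = s
    & forall r, U r -> (\matrix_(i, k) partial i (z k) r) \in unitmx].

(* E = sum_k (dPhi^k)^2 on U for some curvilinear coordinates Phi of U. *)
Definition euclidean_metric_on (R : realType) (n : nat) (U : set 'rV[R]_n)
    (E : 'rV[R]_n -> 'M[R]_n) : Prop :=
  exists2 Phi : 'I_n -> 'rV[R]_n -> R, coordinates_on U Phi &
    forall r, U r ->
      E r = \matrix_(i, j) \sum_k partial i (Phi k) r * partial j (Phi k) r.

Section Frame.
Variables (R : realType) (S : FFPD_space R 3) (x : mpoint S) (e : 'M[R]_3).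
(* The rows of e are the frame vectors; r = (R^1, R^2, R^3) is the row of frame
   components of the tangent vector r *m e. *)
Implicit Types r v : 'rV[R]_3.

Definition adapted_frame : Prop :=
  e *m metric_a x *m e^T = 1%:M /\ row ord_max e = b_up x.

Definition off_axis : set 'rV[R]_3 := [set r | 0 < fq x (r *m e)].

Definition frameK r : R := fK x (r *m e).
Definition frame_chi r : R := fchi x (r *m e).

Definition frame_metric r : 'M[R]_3 :=
  e *m metric_tensor x (r *m e) *m e^T.

(* g_rs(R) dR^r dR^s on the increment v. *)
Definition ds2 r v : R := (v *m frame_metric r *m v^T) 0 0.

(* The polar angle is determined modulo 2 pi only, so it is given by its
   continuous branches. *)
Definition polar_angle_on (U : set 'rV[R]_3) (phi : 'rV[R]_3 -> R) : Prop :=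
  [/\ open U, U `<=` off_axis, (forall r, U r -> {for r, continuous phi})
    & forall r, U r -> r 0 0 = fq x (r *m e) * cos (phi r) /\
                       r 0 1 = fq x (r *m e) * sin (phi r)].

Definition finsleroid_coord (phi : 'rV[R]_3 -> R) (k : 'I_3)
  : 'rV[R]_3 -> R := nth frameK [:: frameK; phi; frame_chi] k.

Definition varkappa r : R := (hpar x)^-1 * frameK r `^ (1 - hpar x).

End Frame.

(* Main.v *)
Require Import Defs.
From HB Require Import structures.
From mathcomp Require Import all_boot all_order all_algebra.
From mathcomp Require Import all_classical all_reals all_analysis.
From mathcomp Require Import ring lra.
Import Order.TTheory GRing.Theory Num.Theory.
Import numFieldNormedType.Exports.
Local Open Scope classical_set_scope.
Local Open Scope ring_scope.

(** Write R^1, R^2, b for the frame components of a tangent vector, q for its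
distance to the axis, A = b + g q / 2 and B = A^2 + h^2 q^2.  Then
cos (h chi) = A / sqrt B and sin (h chi) = h q / sqrt B, and every differential
that occurs is rational in R^1, R^2, b, q up to a known factor:
d chi = (b dq - q db) / B, dK = K ((b + g q) db + q dq) / B,
d phi = (R^1 dR^2 - R^2 dR^1) / q^2.

With E = K^2 / B = exp (- g chi), the gradient of K^2 / 2 is
E (R^1, R^2, b + g q), so one more differentiation gives the metric tensor
([is_diff_half_dK2]); that the tensor computed in an arbitrary basis of T_xM is
this Hessian after transport to the frame is [frame_metricE].  As a quadratic
form the Hessian is the sum of squares
E (B ((dlog K)^2 + d chi^2) + q^2 d phi^2) ([half_hessK2_diag]), and
E B = K^2, E q^2 = K^2 sin^2 (h chi) / h^2: this is the diagonal representation.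

The map (K, chi, phi) to spherical coordinates of radius K^h, polar angle h chi
and azimuth phi turns the Euclidean metric into
h^2 K^(2 h - 2) (dK^2 + K^2 (d chi^2 + sin^2 (h chi) d phi^2 / h^2)), which is
ds^2 divided by the square of K^(1 - h) / h.  In Cartesian form these
coordinates are W (h R^1, h R^2, A) with W = K^h / sqrt B; they do not involve
phi and so are defined on the whole complement of the axis
([half_hessK2_flat], [conformal_factor_sqr], [flat_coord_inj]).

The remaining work is analytic.  Smoothness of K, chi, phi and of the flat
coordinates follows from closure of C^k under the arithmetic operations, the
square root, exp and ln, and, for functions whose differential is explicit, from
smoothness of that differential ([smooth_is_diff]).  A Jacobian is invertible
because the differentials dK, d chi, d phi vanish together only on the zero
vector ([polar_diff_inj]). *)

(** * Differentials of real functions *)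

Section Differential.
Set Implicit Arguments.
Unset Strict Implicit.
Context (R : realType) (V : normedModType R).
Implicit Types (F G : V -> R) (y v : V).

Lemma is_diff_add F G dF dG y : is_diff y F dF -> is_diff y G dG ->
  is_diff y (fun r => F r + G r) (fun v => dF v + dG v).
Proof. by move=> *; exact: is_diffD. Qed.

Lemma is_diff_mul F G dF dG y : is_diff y F dF -> is_diff y G dG ->
  is_diff y (fun r => F r * G r) (fun v => F y * dG v + G y * dF v).
Proof. by move=> *; exact: is_diffM. Qed.

Lemma is_diff_const (c : R) y : is_diff y (fun=> c) (fun=> 0).
Proof. exact: is_diff_cst. Qed.

Lemma is_diff_scale (c : R) F dF y : is_diff y F dF ->
  is_diff y (fun r => c * F r) (fun v => c * dF v).
Proof. by move=> *; exact: is_diffZ. Qed.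

Lemma is_diff_chain (psi : R -> R) d F dF y :
  is_diff y F dF -> is_derive (F y) 1 psi d ->
  is_diff y (fun r => psi (F r)) (fun v => d * dF v).
Proof.
move=> FD [psiD psiE]; have psiD' := psiD; move/derivable1_diffP : psiD' => psid.
apply: (@is_diff_eq _ _ _ _ (( *:%R^~ d) \o dF)).
  apply: is_diff_comp; split => //.
  by rewrite deriv1E// derive1E psiE.
by apply/funext => v /=; rewrite /GRing.scale/= mulrC.
Qed.

Lemma is_diff_ext F dF dG y : is_diff y F dF -> (forall v, dF v = dG v) ->
  is_diff y F dG.
Proof. by move=> FD /funext E; apply: is_diff_eq. Qed.

(** G - F vanishes near y, so it has zero differential at y. *)
Lemma is_diff_near F G dF y : (\forall r \near y, F r = G r) ->
  is_diff y F dF -> is_diff y G dF.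
Proof.
move=> FG FD.
have Zo : (G - F) \o shift y = cst ((G - F) y) + (\0 : V -> R) +o_ 0 id.
  have Zy : (G - F) y = 0.
    by rewrite /GRing.opp/= /GRing.add/= (nbhs_singleton FG) subrr.
  rewrite Zy; apply/eqaddoE.
  have -> : (cst 0 + \0 : V -> R) = 0 by apply/funext => v; rewrite /= /GRing.add/= addr0.
  rewrite add0r littleoE// => eps eps0.
  have : \forall h \near (0 : V), F (h + y) = G (h + y).
    by move: FG; rewrite (near_shift 0)/= subr0.
  apply: filterS => h FGh.
  have -> : ((G - F) \o shift y) h = G (h + y) - F (h + y) by [].
  rewrite FGh subrr normr0.
  by rewrite mulr_ge0// ltW.
have ZD : is_diff y (G - F) (\0 : V -> R).
  have ZE : 'd (G - F) y = (\0 : V -> R) :> (V -> R).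
    by apply: diff_unique => //; exact: cst_continuous.
  split => //; apply/diff_locallyP; rewrite ZE; split => //.
  exact: cst_continuous.
have := is_diffD FD ZD.
rewrite addrC subrK => GD; apply: (is_diff_eq GD).
by apply/funext => v; rewrite /GRing.add/= addr0.
Qed.
End Differential.

(** * Smooth functions on an open set *)

Section Smooth.
Set Implicit Arguments.
Unset Strict Implicit.
Context (R : realType) (n : nat).
Implicit Types (F G : 'rV[R]_n -> R) (U : set 'rV[R]_n) (y v : 'rV[R]_n).

Lemma partial_is_diff F dF y i : is_diff y F dF ->
  partial i F y = dF (delta_mx 0 i).
Proof. by move=> [FD FE]; rewrite /partial deriveE// FE. Qed.

Lemma open_near_eq U F G y : open U -> U y -> {in U, F =1 G} ->
  \forall r \near y, F r = G r.
Proof.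
move=> Uo Uy FG; have := open_nbhs_nbhs (conj Uo Uy).
by apply: filterS => r Ur; apply: FG; rewrite inE.
Qed.

Lemma continuous_near (T : topologicalType) (f f' : T -> R) (t : T) :
  (\forall r \near t, f r = f' r) ->
  {for t, continuous f} -> {for t, continuous f'}.
Proof.
move=> ff' fc; have ft : f r @[r --> t] --> f t := fc.
suff : f' r @[r --> t] --> f' t by [].
by rewrite -(nbhs_singleton ff'); apply: cvg_trans ft; exact: near_eq_cvg.
Qed.

(** Partial derivatives at a point of an open set see only values in that set; thus
functions may be replaced by formulas that are valid on U only. *)
Lemma Ck_ext k U F G : open U -> {in U, F =1 G} -> Ck_on k U F -> Ck_on k U G.
Proof.
move=> Uo; elim: k F G => [|k IH] F G FG /=.
  move=> FC y Uy; have FGn := open_near_eq Uo Uy FG.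
  exact: continuous_near FGn (FC _ Uy).
move=> [FD FP]; split=> [y Uy|i].
  have FGn := open_near_eq Uo Uy FG.
  by have [] := is_diff_near FGn (differentiableP (FD _ Uy)).
apply: IH (FP i) => y; rewrite inE => Uy.
have FGn := open_near_eq Uo Uy FG.
exact: near_eq_derive.
Qed.

Lemma Ck_is_diff k U F dF : open U ->
  (forall y, U y -> is_diff y F (dF y)) ->
  (forall i, Ck_on k U (fun y => dF y (delta_mx 0 i))) -> Ck_on k.+1 U F.
Proof.
move=> Uo FD FP; split=> [y Uy|i]; first by case: (FD _ Uy).
apply: Ck_ext (FP i) => // y; rewrite inE => Uy.
by rewrite (partial_is_diff _ (FD _ Uy)).
Qed.

Lemma Ck_pred k U F : Ck_on k.+1 U F -> Ck_on k U F.
Proof.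
elim: k F => [|k IH] F [FD FP].
  by move=> y Uy; apply: differentiable_continuous; exact: FD.
by split=> // i; apply: IH.
Qed.

Lemma Ck_const k U (c : R) : open U -> Ck_on k U (fun=> c).
Proof.
move=> Uo; elim: k c => [|k IH] c; first by move=> y _; exact: cst_continuous.
by apply: Ck_is_diff (fun y _ => is_diff_const c y) _ => // i; exact: IH.
Qed.

Lemma Ck_diff k U F i : open U -> Ck_on k.+1 U F ->
  Ck_on k U (fun y => 'd F y (delta_mx 0 i)).
Proof.
move=> Uo [FD FP]; apply: Ck_ext (FP i) => // y; rewrite inE => Uy.
by rewrite /partial deriveE//; exact: FD.
Qed.

Lemma Ck_differentiableP k U F y : Ck_on k.+1 U F -> U y -> is_diff y F ('d F y).
Proof. by move=> [FD _] Uy; exact/differentiableP/FD. Qed.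

Lemma Ck_add k U F G : open U -> Ck_on k U F -> Ck_on k U G ->
  Ck_on k U (fun y => F y + G y).
Proof.
move=> Uo; elim: k F G => [|k IH] F G FC GC.
  by move=> y Uy; exact: continuousD (FC _ Uy) (GC _ Uy).
apply: Ck_is_diff => // [y Uy|i].
  by apply: is_diff_add; [exact: Ck_differentiableP FC Uy
                         |exact: Ck_differentiableP GC Uy].
by apply: IH; exact: Ck_diff.
Qed.

Lemma Ck_mul k U F G : open U -> Ck_on k U F -> Ck_on k U G ->
  Ck_on k U (fun y => F y * G y).
Proof.
move=> Uo; elim: k F G => [|k IH] F G FC GC.
  by move=> y Uy; exact: continuousM (FC _ Uy) (GC _ Uy).
apply: Ck_is_diff => // [y Uy|i].
  by apply: is_diff_mul; [exact: Ck_differentiableP FC Uy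
                         |exact: Ck_differentiableP GC Uy].
by apply: Ck_add => //; apply: IH; (exact: Ck_pred || exact: Ck_diff).
Qed.

(** The derivative of psi need only be C^k along F; applied with psi and its
derivative expressed through psi itself, this is the inductive step for
compositions with exp, inversion and the square root. *)
Lemma Ck_chain k U F (psi dpsi : R -> R) : open U ->
  (forall y, U y -> is_derive (F y) 1 psi (dpsi (F y))) ->
  Ck_on k.+1 U F -> Ck_on k U (fun y => dpsi (F y)) ->
  Ck_on k.+1 U (fun y => psi (F y)).
Proof.
move=> Uo psiD FC dC; apply: Ck_is_diff => // [y Uy|i].
  exact: is_diff_chain (Ck_differentiableP FC Uy) (psiD _ Uy).
by apply: Ck_mul => //; exact: Ck_diff.
Qed.

Lemma Ck_cont_chain U F (psi : R -> R) :
  (forall y, U y -> {for F y, continuous psi}) ->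
  Ck_on 0 U F -> Ck_on 0 U (fun y => psi (F y)).
Proof. by move=> psiC FC y Uy; exact: continuous_comp (FC _ Uy) (psiC _ Uy). Qed.

(** For chi and phi, which are defined through inverse trigonometric functions, the
differential is rational in functions already known to be smooth. *)
Lemma smooth_is_diff U F dF : open U ->
  (forall y, U y -> is_diff y F (dF y)) ->
  (forall i, smooth_on U (fun y => dF y (delta_mx 0 i))) -> smooth_on U F.
Proof.
move=> Uo FD FP k; apply: Ck_pred; apply: Ck_is_diff FD _ => // i.
exact: FP.
Qed.

Lemma smooth_ext U F G : open U -> {in U, F =1 G} -> smooth_on U F ->
  smooth_on U G.
Proof. by move=> Uo FG FS k; exact: Ck_ext (FS k). Qed.

Lemma smooth_const U (c : R) : open U -> smooth_on U (fun=> c).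
Proof. by move=> Uo k; exact: Ck_const. Qed.

Lemma is_diff_coord i y : is_diff y (fun r => r 0 i) (fun v => v 0 i).
Proof.
have @f : {linear 'rV[R]_n -> R}.
  by exists (fun r : 'rV[R]_n => r 0 i); do 2![eexists]; do ?[constructor];
     rewrite ?mxE// => ? *; rewrite ?mxE//; move=> ?; rewrite !mxE.
rewrite -[X in is_diff _ X]/(f : _ -> _); split.
  exact/linear_differentiable/coord_continuous.
by rewrite diff_lin//; exact/coord_continuous.
Qed.

Lemma smooth_coord U i : open U -> smooth_on U (fun r => r 0 i).
Proof.
move=> Uo; apply: smooth_is_diff => // [y _|j]; first exact: is_diff_coord.
exact: smooth_const.
Qed.

Lemma smooth_add U F G : open U -> smooth_on U F -> smooth_on U G ->
  smooth_on U (fun y => F y + G y).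
Proof. by move=> Uo FS GS k; exact: Ck_add. Qed.

Lemma smooth_mul U F G : open U -> smooth_on U F -> smooth_on U G ->
  smooth_on U (fun y => F y * G y).
Proof. by move=> Uo FS GS k; exact: Ck_mul. Qed.

Lemma smooth_opp U F : open U -> smooth_on U F -> smooth_on U (fun y => - F y).
Proof.
move=> Uo FS; apply: (@smooth_ext _ (fun y => -1 * F y)) => //.
  by move=> y _; rewrite mulN1r.
by apply: smooth_mul => //; exact: smooth_const.
Qed.

Lemma smooth_exp U F : open U -> smooth_on U F ->
  smooth_on U (fun y => expR (F y)).
Proof.
move=> Uo FS; elim=> [|k IH].
  by apply: Ck_cont_chain (FS 0) => y _; exact: continuous_expR.
by apply: (@Ck_chain k U F expR expR).
Qed.

Lemma is_derive_inv (t : R) : t != 0 -> is_derive t 1 GRing.inv (- (t^-1 * t^-1)).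
Proof.
move=> t0; have dV := @is_deriveV R id t 1 1 t0 (is_derive_id _ _).
apply: (is_derive_eq dV).
by rewrite /GRing.scale/= mulr1 -invfM -expr2.
Qed.

Lemma smooth_inv U F : open U -> (forall y, U y -> F y != 0) ->
  smooth_on U F -> smooth_on U (fun y => (F y)^-1).
Proof.
move=> Uo F0 FS; elim=> [|k IH].
  by apply: Ck_cont_chain (FS 0) => y Uy; apply: inv_continuous; exact: F0.
apply: (@Ck_chain k U F GRing.inv (fun t => - (t^-1 * t^-1))) => //.
  by move=> y Uy; apply: is_derive_inv; exact: F0.
apply: (@Ck_ext _ _ (fun y => -1 * ((F y)^-1 * (F y)^-1))) => //.
  by move=> y _; rewrite mulN1r.
by apply: Ck_mul => //; [exact: Ck_const|exact: Ck_mul].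
Qed.

Lemma smooth_sqrt U F : open U -> (forall y, U y -> 0 < F y) ->
  smooth_on U F -> smooth_on U (fun y => Num.sqrt (F y)).
Proof.
move=> Uo F0 FS; elim=> [|k IH].
  by apply: Ck_cont_chain (FS 0) => y _; exact: sqrt_continuous.
apply: (@Ck_chain k U F Num.sqrt (fun t => (2 * Num.sqrt t)^-1)) => //.
  by move=> y Uy; apply: is_derive1_sqrt; exact: F0.
(* 1 / (2 sqrt F) is sqrt F / (2 F), and the induction hypothesis covers sqrt F. *)
apply: (@Ck_ext _ _ (fun y => Num.sqrt (F y) * (2 * F y)^-1)) => //.
  move=> y; rewrite inE => /F0 Fy; rewrite -{2}(sqr_sqrtr (ltW Fy)).
  have s0 : Num.sqrt (F y) != 0 by rewrite gt_eqF// sqrtr_gt0.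
  by field.
apply: Ck_mul => //; apply: smooth_inv => // [y /F0 Fy|].
  by rewrite mulf_neq0// gt_eqF.
by apply: smooth_mul => //; exact: smooth_const.
Qed.

Lemma smooth_ln U F : open U -> (forall y, U y -> 0 < F y) ->
  smooth_on U F -> smooth_on U (fun y => ln (F y)).
Proof.
move=> Uo F0 FS k; apply: Ck_pred.
apply: (@Ck_chain k U F (@ln R) GRing.inv) => //.
  by move=> y Uy; apply: is_derive1_ln; exact: F0.
by apply: smooth_inv => // y /F0; exact: lt0r_neq0.
Qed.
End Smooth.

(** * Linear and bilinear forms on row vectors *)
Section Linear.
Set Implicit Arguments.
Unset Strict Implicit.
Context (R : realType) (n : nat).
Implicit Types (F : 'rV[R]_n -> R) (c : 'M[R]_n) (y v w : 'rV[R]_n).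

(** Both sides are limits of the same difference quotient. *)
Lemma derive_mulmx F c v y :
  'D_v (fun z => F (z *m c)) y = 'D_(v *m c) F (y *m c).
Proof.
rewrite /derive; set f1 := (X in lim (X @ _) = _).
set f2 := (X in _ = lim (X @ _)); suff -> : f1 = f2 by [].
by apply/funext => t; rewrite /f1 /f2 /= mulmxDl scalemxAl.
Qed.

Lemma scalar_sum (f : 'rV[R]_n -> R) : scalar f ->
  forall v, f v = \sum_i v 0 i * f (delta_mx 0 i).
Proof.
move=> lf v; pose fL : {scalar 'rV[R]_n} :=
  HB.pack f (GRing.isLinear.Build _ _ _ _ _ lf).
rewrite {1}[v]row_sum_delta -[LHS]/(fL _) raddf_sum.
by apply: eq_bigr => i _; exact: (scalarZ fL).
Qed.

Lemma bilinear_mx (f : 'rV[R]_n -> 'rV[R]_n -> R) :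
  (forall w, scalar (f^~ w)) -> (forall v, scalar (f v)) ->
  forall v w, f v w =
    (v *m (\matrix_(i, j) f (delta_mx 0 i) (delta_mx 0 j)) *m w^T) 0 0.
Proof.
move=> fl fr v w; rewrite (scalar_sum (fr _)) mxE; apply: eq_bigr => j _.
rewrite (scalar_sum (fl _)) mulrC !mxE; congr (_ * _).
by apply: eq_bigr => i _; rewrite mxE.
Qed.

Lemma unit_jacobian (z dz : 'I_n -> 'rV[R]_n -> R) y :
  (forall k, is_diff y (z k) (dz k)) ->
  (forall v, (forall k, dz k v = 0) -> v = 0) ->
  (\matrix_(i, k) partial i (z k) y) \in unitmx.
Proof.
move=> zD inj; rewrite -row_free_unit; apply: inj_row_free => v v0.
apply: inj => k; have [_ dzE] := zD k.
have dl : scalar (dz k) by rewrite -dzE; exact: linearP.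
move/rowP/(_ k): v0; rewrite !mxE => v0.
rewrite (scalar_sum dl) -[RHS]v0; apply: eq_bigr => i _.
by rewrite mxE (partial_is_diff i (zD k)).
Qed.
End Linear.

(** * The Finsleroid functions of the frame components *)

Section Model.
Set Implicit Arguments.
Unset Strict Implicit.
Context (R : realType) (g : R) (hg : -2 < g < 2).
Implicit Types r s v w y : 'rV[R]_3.

Definition axial r : R := r 0 ord_max.
Definition radial r : R := Num.sqrt (r 0 0 ^+ 2 + r 0 1 ^+ 2).
Definition dradial r v : R := (r 0 0 * v 0 0 + r 0 1 * v 0 1) / radial r.
Definition off_axis3 : set 'rV[R]_3 := [set r | 0 < radial r].

Definition charge_h : R := Num.sqrt (1 - g ^+ 2 / 4).
Definition modelA r : R := axial r + 2^-1 * g * radial r.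
Definition modelB r : R := axial r ^+ 2 + g * axial r * radial r + radial r ^+ 2.
Definition model_chi r : R := acos (modelA r / Num.sqrt (modelB r)) / charge_h.
Definition modelK r : R :=
  Num.sqrt (modelB r) * expR (- (2^-1 * g * model_chi r)).

Local Notation h := charge_h.
Local Notation b := axial.
Local Notation q := radial.
Local Notation dq := dradial.
Local Notation A := modelA.
Local Notation B := modelB.
Local Notation chi := model_chi.
Local Notation K := modelK.

(** K^2 / B *)
Definition modelE r : R := expR (- (g * chi r)).
(** K^h / sqrt B, written so that its smoothness and its differential are immediate. *)
Definition modelW r : R := expR ((h - 1) / 2 * ln (B r) - g * h / 2 * chi r).
(** Cartesian form of the spherical coordinates K^h, h chi, phi. *)
Definition flat_coord (k : 'I_3) : 'rV[R]_3 -> R :=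
  nth (fun=> 0) [:: (fun r => modelW r * (h * r 0 0));
    (fun r => modelW r * (h * r 0 1)); (fun r => modelW r * A r)] k.

(** The differentials of log K, chi, phi, B and K^2 / 2 at r in the direction v, and
the Hessian of K^2 / 2. *)
Definition dlogK r v : R := ((b r + g * q r) * b v + q r * dq r v) / B r.
Definition dchi r v : R := (b r * dq r v - q r * b v) / B r.
Definition dphi r v : R := (r 0 0 * v 0 1 - r 0 1 * v 0 0) / q r ^+ 2.
Definition dmodelB r v : R :=
  2 * b r * b v + g * (b r * dq r v + q r * b v) + 2 * q r * dq r v.
Definition half_dK2 r v : R :=
  modelE r * (r 0 0 * v 0 0 + r 0 1 * v 0 1 + (b r + g * q r) * b v).
Definition half_hessK2 r v w : R :=
  modelE r * (v 0 0 * w 0 0 + v 0 1 * w 0 1 + b v * b w + g * dq r v * b w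
    - g * dchi r v * (q r * dq r w + (b r + g * q r) * b w)).

Let hsqr_gt0 : 0 < 1 - g ^+ 2 / 4.
Proof. by case/andP: hg => ? ?; nra. Qed.

Lemma charge_h_sqr : h ^+ 2 = 1 - g ^+ 2 / 4.
Proof. by rewrite sqr_sqrtr// ltW. Qed.

Lemma charge_h_gt0 : 0 < h.
Proof. by rewrite sqrtr_gt0. Qed.

Lemma radial_sqr r : q r ^+ 2 = r 0 0 ^+ 2 + r 0 1 ^+ 2.
Proof. by rewrite sqr_sqrtr// addr_ge0// sqr_ge0. Qed.

(** The discriminant of the quadratic form B is g^2 - 4 = - 4 h^2. *)
Lemma modelB_sqr r : B r = A r ^+ 2 + h ^+ 2 * q r ^+ 2.
Proof. by rewrite charge_h_sqr /modelB /modelA; field. Qed.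

Lemma modelB_gt0 r : off_axis3 r -> 0 < B r.
Proof.
rewrite /off_axis3/= => q0; rewrite modelB_sqr ltr_wpDl ?sqr_ge0//.
by rewrite mulr_gt0 ?exprn_gt0 ?charge_h_gt0.
Qed.

Lemma sqrtB_gt0 r : off_axis3 r -> 0 < Num.sqrt (B r).
Proof. by move=> /modelB_gt0; rewrite sqrtr_gt0. Qed.

Lemma open_off_axis3 : open off_axis3.
Proof.
have qc : continuous q.
  move=> r; have c i := is_diff_coord i r.
  have [sd _] := is_diff_add (is_diff_mul (c 0) (c 0)) (is_diff_mul (c 1) (c 1)).
  by apply: continuous_comp (differentiable_continuous sd) _; exact: sqrt_continuous.
have -> : off_axis3 = q @^-1` [set t | 0 < t] by [].
by apply: open_comp => //; exact: open_gt.
Qed.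

Section Point.
Context (r : 'rV[R]_3) (hr : off_axis3 r).

Let q0 : q r != 0. Proof. by rewrite gt_eqF. Qed.
Let h0 : h != 0. Proof. by rewrite gt_eqF// charge_h_gt0. Qed.
Let B0 : B r != 0. Proof. by rewrite gt_eqF// modelB_gt0. Qed.
Let S0 : Num.sqrt (B r) != 0. Proof. by rewrite gt_eqF// sqrtB_gt0. Qed.
Let SB : Num.sqrt (B r) ^+ 2 = B r.
Proof. by rewrite sqr_sqrtr// ltW// modelB_gt0. Qed.

Let cosf_lt : -1 < A r / Num.sqrt (B r) < 1.
Proof.
have S := sqrtB_gt0 hr; rewrite -ltr_norml -(@ltr_pXn2r _ 2) ?nnegrE// expr1n.
rewrite -normrX ger0_norm ?sqr_ge0// expr_div_n SB ltr_pdivrMr ?modelB_gt0//.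
by rewrite mul1r modelB_sqr ltrDl mulr_gt0 ?exprn_gt0 ?charge_h_gt0.
Qed.

Let hchi : h * chi r = acos (A r / Num.sqrt (B r)).
Proof. by rewrite /model_chi mulrC divfK. Qed.

Let sin_f : Num.sqrt (1 - (A r / Num.sqrt (B r)) ^+ 2) = h * q r / Num.sqrt (B r).
Proof.
have -> : 1 - (A r / Num.sqrt (B r)) ^+ 2 = (h * q r / Num.sqrt (B r)) ^+ 2.
  by rewrite !expr_div_n SB exprMn -[1](divff B0) -mulrBl [in X in X - _]modelB_sqr addrC addKr.
by rewrite sqrtr_sqr ger0_norm// divr_ge0 ?sqrtr_ge0// mulr_ge0 ?ltW ?charge_h_gt0.
Qed.

Lemma cos_chi : cos (h * chi r) = A r / Num.sqrt (B r).
Proof. by rewrite hchi acosK// in_itv/=; case/andP: cosf_lt => /ltW-> /ltW->. Qed.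

Lemma sin_chi : sin (h * chi r) = h * q r / Num.sqrt (B r).
Proof. by rewrite hchi sin_acos ?sin_f//; case/andP: cosf_lt => /ltW-> /ltW->. Qed.

Lemma is_diff_axial : is_diff r b b.
Proof. exact: is_diff_coord. Qed.

Lemma is_diff_radial : is_diff r q (dq r).
Proof.
have s0 : 0 < r 0 0 ^+ 2 + r 0 1 ^+ 2 by rewrite -radial_sqr exprn_gt0.
have c i := is_diff_coord i r.
have sD := is_diff_add (is_diff_mul (c 0) (c 0)) (is_diff_mul (c 1) (c 1)).
have qD : is_diff r q _ := is_diff_chain sD (is_derive1_sqrt s0).
apply: is_diff_ext qD _ => v /=.
by rewrite -/(q r) /dradial; field.
Qed.

Lemma is_diff_modelB : is_diff r B (dmodelB r).
Proof.
have bD := is_diff_axial; have qD := is_diff_radial.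
have BD := is_diff_add (is_diff_add (is_diff_mul bD bD)
  (is_diff_mul (is_diff_scale g bD) qD)) (is_diff_mul qD qD).
by apply: is_diff_ext BD _ => v; rewrite /dmodelB; ring.
Qed.

Lemma is_diff_chi : is_diff r chi (dchi r).
Proof.
have bD := is_diff_axial; have qD := is_diff_radial; have BD := is_diff_modelB.
have AD := is_diff_add bD (is_diff_scale (2^-1 * g) qD).
have SD := is_diff_chain BD (is_derive1_sqrt (modelB_gt0 hr)).
have iD := is_diff_chain SD (is_derive_inv S0).
have fD := is_diff_chain (is_diff_mul AD iD) (is_derive1_acos cosf_lt).
have := is_diff_scale h^-1 fD.
rewrite -[X in is_diff _ X _](_ : chi = _); last first.
  by apply/funext => y; rewrite /model_chi mulrC.
move/is_diff_ext; apply => v; rewrite sin_f /= /dchi.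
(* the differential of A / sqrt B is this combination over 2 B sqrt B, with the
   opposite sign *)
have key : A r * dmodelB r v - 2 * B r * (b v + 2^-1 * g * dq r v) =
    2 * h ^+ 2 * q r * (b r * dq r v - q r * b v).
  by rewrite charge_h_sqr /modelA /modelB /dmodelB; field.
move: (Num.sqrt (B r)) S0 SB => S S0' SB'; rewrite -SB' in key *.
have -> : b r * dq r v - q r * b v =
    (A r * dmodelB r v - 2 * S ^+ 2 * (b v + 2^-1 * g * dq r v)) / (2 * h ^+ 2 * q r).
  by rewrite key; field; rewrite q0 h0.
by rewrite -/(A r); field; rewrite q0 h0 S0'.
Qed.

Lemma is_diff_modelK : is_diff r K (fun v => K r * dlogK r v).
Proof.
have SD := is_diff_chain is_diff_modelB (is_derive1_sqrt (modelB_gt0 hr)).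
have eD := is_diff_chain (is_diff_scale (- (2^-1 * g)) is_diff_chi) (is_derive_expR _).
have KD := is_diff_mul SD eD.
rewrite -[X in is_diff _ X _](_ : K = _) in KD; last first.
  by apply/funext => y; rewrite /modelK mulNr.
apply: is_diff_ext KD _ => v /=; rewrite /modelK !mulNr /dchi /dlogK /dmodelB.
move: (Num.sqrt (B r)) S0 SB => S S0' SB'; rewrite -SB'.
move: (expR _) => E; by field.
Qed.

Lemma modelK_gt0 : 0 < K r.
Proof. by rewrite mulr_gt0 ?expR_gt0 ?sqrtB_gt0. Qed.

Let qdq v : q r * dq r v = r 0 0 * v 0 0 + r 0 1 * v 0 1.
Proof. by rewrite /dradial; field. Qed.

Lemma modelK_sqr : K r ^+ 2 = B r * modelE r.
Proof.
rewrite exprMn SB; congr (_ * _); rewrite expr2 -expRD; congr expR; by field.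
Qed.

Lemma is_diff_modelE : is_diff r modelE (fun v => - g * modelE r * dchi r v).
Proof.
have ED := is_diff_chain (is_diff_scale (- g) is_diff_chi) (is_derive_expR _).
rewrite -[X in is_diff _ X _](_ : modelE = _) in ED; last first.
  by apply/funext => y; rewrite /modelE mulNr.
by apply: is_diff_ext ED _ => v /=; rewrite /modelE mulNr; ring.
Qed.

Lemma is_diff_modelK_sqr : is_diff r (fun r' => K r' ^+ 2)
  (fun v => 2 * half_dK2 r v).
Proof.
have K2D := is_diff_mul is_diff_modelK is_diff_modelK.
rewrite -[X in is_diff _ X _](_ : (fun r' => K r' ^+ 2) = _) in K2D; last first.
  by apply/funext => y; rewrite expr2.
apply: is_diff_ext K2D _ => v; rewrite /half_dK2 -qdq.
have -> : K r * (K r * dlogK r v) = K r ^+ 2 * dlogK r v by ring.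
rewrite modelK_sqr /dlogK; by field.
Qed.

Lemma is_diff_half_dK2 w : is_diff r (fun r' => half_dK2 r' w)
  (fun v => half_hessK2 r v w).
Proof.
have c i := is_diff_coord i r.
have bD := is_diff_axial; have qD := is_diff_radial.
have m i := is_diff_mul (c i) (is_diff_const (w 0 i) r).
have m2 := is_diff_mul (is_diff_add bD (is_diff_scale g qD)) (is_diff_const (b w) r).
have D := is_diff_mul is_diff_modelE (is_diff_add (is_diff_add (m 0) (m 1)) m2).
apply: is_diff_ext D _ => v; rewrite /half_hessK2 qdq /axial /=; ring.
Qed.

(** (R^1 v^1 + R^2 v^2)^2 + (R^1 v^2 - R^2 v^1)^2 = q^2 ((v^1)^2 + (v^2)^2)
splits off the angular part; what remains is a quadratic form in db and dq,
where the coefficients agree because B = b^2 + g b q + q^2. *)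
Lemma half_hessK2_diag v : half_hessK2 r v v =
  modelE r * (B r * (dlogK r v ^+ 2 + dchi r v ^+ 2) + q r ^+ 2 * dphi r v ^+ 2).
Proof.
have e : v 0 0 * v 0 0 + v 0 1 * v 0 1 = dq r v ^+ 2 + q r ^+ 2 * dphi r v ^+ 2.
  rewrite /dphi /dradial.
  have -> : forall a c : R, (a / q r) ^+ 2 + q r ^+ 2 * (c / q r ^+ 2) ^+ 2 =
    (a ^+ 2 + c ^+ 2) / q r ^+ 2 by move=> a c; field.
  apply: (@mulIf _ (q r ^+ 2)); first by rewrite expf_neq0.
  by rewrite divfK ?expf_neq0// radial_sqr; ring.
rewrite /half_hessK2 e; congr (_ * _); rewrite /dlogK /dchi.
move: B0; rewrite /modelB => B0'; by field.
Qed.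

Lemma half_hessK2_eq0 v : half_hessK2 r v v = 0 ->
  [/\ dlogK r v = 0, dchi r v = 0 & dphi r v = 0].
Proof.
rewrite half_hessK2_diag => /eqP; rewrite mulf_eq0 gt_eqF ?expR_gt0//=.
have BB := modelB_gt0 hr.
rewrite paddr_eq0; first 1 last.
- by rewrite mulr_ge0 ?(ltW BB)// addr_ge0 ?sqr_ge0.
- by rewrite mulr_ge0 ?sqr_ge0.
move=> /andP[].
rewrite mulf_eq0 (negPf B0)/= paddr_eq0 ?sqr_ge0// !sqrf_eq0.
move=> /andP[/eqP-> /eqP->]; rewrite mulf_eq0 !sqrf_eq0 (negPf q0)/=.
by move/eqP ->.
Qed.

(** In db and dq, dlog K and d chi have the determinant
((b + g q) b + q^2) / B^2 = 1 / B; in dR^1 and dR^2, the forms q dq and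
q^2 d phi have the determinant q^2. *)
Lemma polar_diff_inj v : dlogK r v = 0 -> dchi r v = 0 -> dphi r v = 0 -> v = 0.
Proof.
have nz (a c : R) : c != 0 -> a / c = 0 -> a = 0.
  by move=> c0 /eqP; rewrite mulf_eq0 invr_eq0 (negPf c0) orbF => /eqP.
move=> /(nz _ _ B0) X /(nz _ _ B0) Y /(nz _ _ (expf_neq0 2 q0)) Z.
have bv : b v = 0.
  apply: (mulfI B0); rewrite mulr0.
  transitivity (b r * ((b r + g * q r) * b v + q r * dq r v)
    - q r * (b r * dq r v - q r * b v)); first by rewrite /modelB; ring.
  by rewrite X Y; ring.
have dv : r 0 0 * v 0 0 + r 0 1 * v 0 1 = 0.
  by rewrite -qdq; move: X; rewrite bv mulr0 add0r.
have v0 : v 0 0 = 0.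
  apply: (mulfI (expf_neq0 2 q0)); rewrite mulr0 radial_sqr.
  transitivity (r 0 0 * (r 0 0 * v 0 0 + r 0 1 * v 0 1)
    - r 0 1 * (r 0 0 * v 0 1 - r 0 1 * v 0 0)); first by ring.
  by rewrite dv Z; ring.
have v1 : v 0 1 = 0.
  apply: (mulfI (expf_neq0 2 q0)); rewrite mulr0 radial_sqr.
  transitivity (r 0 1 * (r 0 0 * v 0 0 + r 0 1 * v 0 1)
    + r 0 0 * (r 0 0 * v 0 1 - r 0 1 * v 0 0)); first by ring.
  by rewrite dv Z; ring.
apply/rowP => -[[|[|[|//]]] i]; rewrite mxE.
- by rewrite -[RHS]v0; congr (v _ _); apply: val_inj.
- by rewrite -[RHS]v1; congr (v _ _); apply: val_inj.
- by rewrite -[RHS]bv; congr (v _ _); apply: val_inj.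
Qed.

(** dlog K^h - dlog (sqrt B) *)
Definition dlogW v : R := h * dlogK r v - dmodelB r v / (2 * B r).

Lemma is_diff_modelW : is_diff r modelW (fun v => modelW r * dlogW v).
Proof.
have lD := is_diff_chain is_diff_modelB (is_derive1_ln (modelB_gt0 hr)).
have WD := is_diff_chain (is_diff_add (is_diff_scale ((h - 1) / 2) lD)
  (is_diff_scale (- (g * h / 2)) is_diff_chi)) (is_derive_expR _).
rewrite -[X in is_diff _ X _](_ : modelW = _) in WD; last first.
  by apply/funext => y; rewrite /modelW mulNr.
apply: is_diff_ext WD _ => v /=; rewrite /modelW mulNr; congr (_ * _).
by rewrite /dlogW /dlogK /dchi /dmodelB; field.
Qed.

Definition dflat (k : 'I_3) v : R := modelW r *
  nth 0 [:: h * (v 0 0 + r 0 0 * dlogW v); h * (v 0 1 + r 0 1 * dlogW v);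
            b v + 2^-1 * g * dq r v + A r * dlogW v] k.

Lemma is_diff_flat k : is_diff r (flat_coord k) (dflat k).
Proof.
have bD := is_diff_axial; have qD := is_diff_radial.
have c i := is_diff_scale h (is_diff_coord i r).
have W i := is_diff_mul is_diff_modelW (c i).
case: k => [[|[|[|//]]] i]; rewrite /flat_coord /dflat /=.
- by apply: is_diff_ext (W 0) _ => v; ring.
- by apply: is_diff_ext (W 1) _ => v; ring.
- have WA := is_diff_mul is_diff_modelW (is_diff_add bD (is_diff_scale (2^-1 * g) qD)).
  by apply: is_diff_ext WA _ => v; rewrite /modelA; ring.
Qed.

(** With om = dlog W, the cross terms of the flat metric collect into
h^2 q dq + A dA = dB / 2 and h^2 q^2 + A^2 = B.  Completing the square in
om + dB / (2 B) = h dlog K removes the terms linear in h, so that only h^2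
remains and the identity becomes rational in g. *)
Lemma half_hessK2_flat v w : h ^+ 2 * modelW r ^+ 2 * half_hessK2 r v w =
  modelE r * \sum_k dflat k v * dflat k w.
Proof.
rewrite !big_ord_recr big_ord0 /dflat /= add0r.
set om := dlogW.
have -> : forall x1 x2 x3 y1 y2 y3 W : R, W * (h * x1) * (W * (h * y1)) +
    W * (h * x2) * (W * (h * y2)) + W * x3 * (W * y3) =
    W ^+ 2 * (h ^+ 2 * (x1 * y1 + x2 * y2) + x3 * y3) by move=> *; ring.
have -> : (v 0 0 + r 0 0 * om v) * (w 0 0 + r 0 0 * om w) +
   (v 0 1 + r 0 1 * om v) * (w 0 1 + r 0 1 * om w) =
   (v 0 0 * w 0 0 + v 0 1 * w 0 1) + (q r * dq r v * om w + q r * dq r w * om v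
   + q r ^+ 2 * (om v * om w)).
  by rewrite !qdq radial_sqr; ring.
rewrite /half_hessK2; set vw := _ + v 0 1 * w 0 1.
pose dA u := b u + 2^-1 * g * dq r u.
(* h^2 q dq + A dA = dB / 2 and h^2 q^2 + A^2 = B, for both vectors *)
have key : h ^+ 2 * (vw + (q r * dq r v * om w + q r * dq r w * om v
      + q r ^+ 2 * (om v * om w))) + (dA v + A r * om v) * (dA w + A r * om w) =
    h ^+ 2 * vw + dA v * dA w + (dmodelB r v * om w + dmodelB r w * om v) / 2
    + B r * (om v * om w).
  by rewrite modelB_sqr charge_h_sqr /dA /modelA /dmodelB; field.
rewrite -/(dA v) -/(dA w) key.
(* completion of the square *)
have -> : dmodelB r v * om w + dmodelB r w * om v =
    2 * (h ^+ 2 * (B r * (dlogK r v * dlogK r w))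
      - dmodelB r v * dmodelB r w / (4 * B r) - B r * (om v * om w)).
  by rewrite /om /dlogW; field.
rewrite [2 * _]mulrC mulfK// addrA subrK.
set T := (T in _ = _ * (_ * T)).
suff -> : T = h ^+ 2 * (vw + b v * b w + g * dq r v * b w
    - g * dchi r v * (q r * dq r w + (b r + g * q r) * b w)) by ring.
rewrite /T charge_h_sqr /dA /dlogK /dchi /dmodelB.
by move: B0; rewrite /modelB => B0'; field.
Qed.

End Point.

Let sqrt_expR (t : R) : 0 < t -> Num.sqrt t = expR (2^-1 * ln t).
Proof.
move=> t0; have -> : t = expR (2^-1 * ln t) ^+ 2.
  by rewrite -expRM_natl mulVKf// lnK.
by rewrite sqrtr_sqr ger0_norm ?expR_ge0// -expRM_natl mulVKf// lnK.
Qed.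

Lemma modelK_exp r : off_axis3 r ->
  K r = expR (2^-1 * ln (B r) - 2^-1 * g * chi r).
Proof.
by move=> /modelB_gt0 B0; rewrite expRD -sqrt_expR.
Qed.

Lemma modelW_sqrtB r : off_axis3 r -> modelW r * Num.sqrt (B r) = K r `^ h.
Proof.
move=> hr; have B0 := modelB_gt0 hr; have K0 := modelK_gt0 hr.
rewrite sqrt_expR// /powR gt_eqF// modelK_exp// expRK /modelW -expRD; congr expR.
by field.
Qed.

(** (K^(1 - h) / h) h W = K / sqrt B *)
Lemma conformal_factor_sqr r : off_axis3 r ->
  (h^-1 * K r `^ (1 - h)) ^+ 2 * (h ^+ 2 * modelW r ^+ 2) = modelE r.
Proof.
move=> hr; have B0 := modelB_gt0 hr; have K0 := modelK_gt0 hr.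
have h0 : h != 0 by rewrite gt_eqF// charge_h_gt0.
have S0 := sqrtB_gt0 hr.
have -> : modelE r = (K r / Num.sqrt (B r)) ^+ 2.
  by rewrite expr_div_n modelK_sqr// sqr_sqrtr ?ltW// mulrC mulKf// gt_eqF.
rewrite -!exprMn; congr (_ ^+ 2).
have -> : modelW r = K r `^ h / Num.sqrt (B r).
  by rewrite -modelW_sqrtB// mulfK// gt_eqF.
rewrite -[X in _ = X / _](powRr1 (ltW K0)) -[X in _ = _ `^ X / _](subrK h).
rewrite [in RHS]powRD; last by rewrite (gt_eqF K0) implybT.
by field; rewrite gt_eqF.
Qed.

Lemma sqrtB_modelK r : Num.sqrt (B r) = K r * expR (2^-1 * g * chi r).
Proof. by rewrite /modelK -[RHS]mulrA -expRD addNr expR0 mulr1. Qed.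

Lemma modelA_chi r : off_axis3 r -> A r = Num.sqrt (B r) * cos (h * chi r).
Proof.
by move=> hr; rewrite cos_chi// mulrC divfK// gt_eqF// sqrtB_gt0.
Qed.

Lemma radial_chi r : off_axis3 r ->
  h * q r = Num.sqrt (B r) * sin (h * chi r).
Proof.
by move=> hr; rewrite sin_chi// [RHS]mulrC divfK// gt_eqF// sqrtB_gt0.
Qed.

(** K and chi determine sqrt B = K exp (g chi / 2), hence A and h q by their polar
form. *)
Lemma axial_radial_inj r s : off_axis3 r -> off_axis3 s ->
  K r = K s -> chi r = chi s -> b r = b s /\ q r = q s.
Proof.
move=> hr hs Krs crs.
have Srs : Num.sqrt (B r) = Num.sqrt (B s) by rewrite !sqrtB_modelK// Krs crs.
have qrs : q r = q s.
  have h0 : h != 0 by rewrite gt_eqF// charge_h_gt0.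
  by apply: (mulfI h0); rewrite !radial_chi// Srs crs.
have := modelA_chi hr; rewrite Srs crs -modelA_chi// /modelA qrs.
by move/addIr.
Qed.

Lemma rV3_eq r s : r 0 0 = s 0 0 -> r 0 1 = s 0 1 -> b r = b s -> r = s.
Proof.
move=> e0 e1 e2; apply/rowP => -[[|[|[|//]]] i].
- by move: e0; congr (_ = _); congr (_ 0 _); apply: val_inj.
- by move: e1; congr (_ = _); congr (_ 0 _); apply: val_inj.
- by move: e2; rewrite /axial; congr (_ = _); congr (_ 0 _); apply: val_inj.
Qed.

(** The Euclidean norm of the flat coordinates is K^h, and the third one divided by
K^h is the cosine of h chi. *)
Lemma flat_coord_inj r s : off_axis3 r -> off_axis3 s ->
  (forall k, flat_coord k r = flat_coord k s) -> r = s.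
Proof.
move=> hr hs Phi.
have P0 := Phi 0; have P1 := Phi 1; have P2 := Phi ord_max.
rewrite /flat_coord /= in P0 P1 P2.
have h0 : h != 0 by rewrite gt_eqF// charge_h_gt0.
have norm t : off_axis3 t -> (modelW t * (h * t 0 0)) ^+ 2 +
   (modelW t * (h * t 0 1)) ^+ 2 + (modelW t * A t) ^+ 2 = (K t `^ h) ^+ 2.
  move=> ht; rewrite -modelW_sqrtB// [in RHS]exprMn sqr_sqrtr ?(ltW (modelB_gt0 ht))//.
  by rewrite modelB_sqr radial_sqr; ring.
have Kh : K r `^ h = K s `^ h.
  have sqr_inj (t u : R) : 0 <= t -> 0 <= u -> t ^+ 2 = u ^+ 2 -> t = u.
    by move=> t0 u0 /eqP; rewrite eqrXn2// => /eqP.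
  apply: (sqr_inj _ _ (powR_ge0 _ _) (powR_ge0 _ _)).
  have e := norm _ hr.
  rewrite P0 P1 P2 in e.
  exact: etrans (esym e) (norm _ hs).
have Krs : K r = K s.
  have hK t : off_axis3 t -> K t = (K t `^ h) `^ h^-1.
    move=> ht; rewrite -powRrM (mulfV h0).
    exact: esym (powRr1 (ltW (modelK_gt0 ht))).
  by rewrite (hK _ hr) Kh -(hK _ hs).
have Phi2 t : off_axis3 t -> modelW t * A t = K t `^ h * (A t / Num.sqrt (B t)).
  move=> ht; rewrite -(modelW_sqrtB ht) -mulrA; congr (_ * _).
  by rewrite [RHS]mulrC (divfK (lt0r_neq0 (sqrtB_gt0 ht))).
have crs : chi r = chi s.
  rewrite /model_chi; congr (acos _ / _).
  have Kh0 : K s `^ h != 0 := lt0r_neq0 (powR_gt0 _ (modelK_gt0 hs)).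
  apply: (mulfI Kh0); rewrite -{1}Kh.
  exact: etrans (esym (Phi2 _ hr)) (etrans P2 (Phi2 _ hs)).
have [brs qrs] := axial_radial_inj hr hs Krs crs.
have W0 : modelW s != 0 := lt0r_neq0 (expR_gt0 _).
have Wrs : modelW r = modelW s by rewrite /modelW crs /modelB brs qrs.
rewrite Wrs in P0 P1.
exact: rV3_eq (mulfI h0 (mulfI W0 P0)) (mulfI h0 (mulfI W0 P1)) brs.
Qed.

(** * Smoothness of the coordinates *)

Section ModelSmooth.
Context (U : set 'rV[R]_3) (Uo : open U) (UA : U `<=` off_axis3).

Let sc (c : R) := smooth_const c Uo.

Lemma smooth_axial : smooth_on U b.
Proof. exact: smooth_coord. Qed.

Lemma smooth_radial : smooth_on U q.
Proof.
have s i := smooth_coord i Uo.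
have s2 := smooth_add Uo (smooth_mul Uo (s 0) (s 0)) (smooth_mul Uo (s 1) (s 1)).
apply: (smooth_sqrt Uo _ s2) => y /UA hy; rewrite -!expr2 -radial_sqr.
exact: exprn_gt0.
Qed.

Lemma smooth_modelB : smooth_on U B.
Proof.
have bS := smooth_axial; have qS := smooth_radial.
exact: smooth_add Uo (smooth_add Uo (smooth_mul Uo bS bS)
  (smooth_mul Uo (smooth_mul Uo (sc g) bS) qS)) (smooth_mul Uo qS qS).
Qed.

Lemma smooth_inv_modelB : smooth_on U (fun y => (B y)^-1).
Proof.
by apply: smooth_inv smooth_modelB => // y /UA /modelB_gt0; exact: lt0r_neq0.
Qed.

Lemma smooth_inv_radial : smooth_on U (fun y => (q y)^-1).
Proof. by apply: smooth_inv smooth_radial => // y /UA; exact: lt0r_neq0. Qed.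

Lemma smooth_chi : smooth_on U chi.
Proof.
have bS := smooth_axial; have qS := smooth_radial.
apply: (smooth_is_diff (dF := dchi)) => // [y /UA hy|i].
  exact: is_diff_chi.
have s j := smooth_mul Uo (smooth_coord j Uo) (sc ((delta_mx 0 i : 'rV_3) 0 j)).
have dqS := smooth_mul Uo (smooth_add Uo (s 0) (s 1)) smooth_inv_radial.
exact: smooth_mul Uo (smooth_add Uo (smooth_mul Uo bS dqS)
  (smooth_opp Uo (smooth_mul Uo qS (sc (b (delta_mx 0 i)))))) smooth_inv_modelB.
Qed.

Lemma smooth_lnB_chi (c d : R) : smooth_on U (fun y => expR (c * ln (B y) - d * chi y)).
Proof.
have lS : smooth_on U (fun y => ln (B y)).
  by apply: smooth_ln smooth_modelB => // y /UA /modelB_gt0.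
apply: smooth_exp => //.
exact: smooth_add Uo (smooth_mul Uo (sc c) lS)
  (smooth_opp Uo (smooth_mul Uo (sc d) smooth_chi)).
Qed.

Lemma smooth_modelK : smooth_on U K.
Proof.
apply: smooth_ext (smooth_lnB_chi _ _) => // y; rewrite inE => /UA hy.
exact/esym/modelK_exp.
Qed.

Lemma smooth_flat_coord k : smooth_on U (flat_coord k).
Proof.
have WS : smooth_on U modelW by exact: smooth_lnB_chi.
have s i := smooth_mul Uo WS (smooth_mul Uo (sc h) (smooth_coord i Uo)).
case: k => [[|[|[|//]]] i]; [exact: (s 0)|exact: (s 1)|].
exact: smooth_mul Uo WS (smooth_add Uo smooth_axial
  (smooth_mul Uo (sc (2^-1 * g)) smooth_radial)).
Qed.

End ModelSmooth.

(** * Branches of the polar angle *)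

Section PolarAngle.
Context (U : set 'rV[R]_3) (phi : 'rV[R]_3 -> R) (Uo : open U)
  (UA : U `<=` off_axis3) (phiC : forall r, U r -> {for r, continuous phi})
  (phiE : forall r, U r -> r 0 0 = q r * cos (phi r) /\ r 0 1 = q r * sin (phi r)).

(** Continuity keeps phi within pi / 2 of phi r near r, where phi - phi r is the
arcsine of sin (phi - phi r), a rational expression in R^1, R^2 and q. *)
Lemma is_diff_phi r : U r -> is_diff r phi (dphi r).
Proof.
move=> Ur; have hr := UA Ur; have q0 : q r != 0 by rewrite gt_eqF.
pose s y := (cos (phi r) * y 0 1 - sin (phi r) * y 0 0) / q y.
have sE y : U y -> s y = sin (phi y - phi r).
  move=> Uy; rewrite /s; have [-> ->] := phiE Uy; rewrite sinB.
  field; exact: lt0r_neq0 (UA Uy).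
have s0 : s r = 0 by rewrite sE// subrr sin0.
have c i := is_diff_coord i r.
have sD := is_diff_mul (is_diff_add (is_diff_scale (cos (phi r)) (c 1))
  (is_diff_scale (- sin (phi r)) (c 0))) (is_diff_chain (is_diff_radial hr) (is_derive_inv q0)).
rewrite -[X in is_diff _ X _](_ : s = _) in sD; last first.
  by apply/funext => y; rewrite /s mulNr.
have s1 : -1 < s r < 1 by rewrite s0 oppr_lt0 ltr01.
have aD := is_diff_add (is_diff_const (phi r) r) (is_diff_chain sD (is_derive1_asin s1)).
have near_phi : \forall y \near r, phi r + asin (s y) = phi y.
  have pi2 : 0 < pi / 2 :> R by rewrite divr_gt0 ?pi_gt0.
  have /cvgrPdist_lt /(_ _ pi2) phin := phiC Ur.
  have Un := open_nbhs_nbhs (conj Uo Ur).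
  near=> y.
  have Uy : U y by near: y.
  rewrite sE// sinK; first by rewrite addrC subrK.
  have : `|phi r - phi y| < pi / 2 by near: y.
  by rewrite distrC in_itv/= -ler_norml => /ltW.
apply: is_diff_near near_phi _.
apply: is_diff_ext aD _ => v; rewrite s0 expr0n subr0 sqrtr1 invr1 add0r mul1r.
have [e0 e1] := phiE Ur.
have num0 : cos (phi r) * r 0 1 + - sin (phi r) * r 0 0 = 0.
  by move: s0; rewrite /s mulNr => /eqP; rewrite mulf_eq0 invr_eq0 (negPf q0) orbF => /eqP.
rewrite num0 mul0r add0r /dphi e0 e1; by field.
Unshelve. all: by end_near. Qed.

Lemma smooth_phi : smooth_on U phi.
Proof.
apply: (smooth_is_diff (dF := dphi)) => // [y|i]; first exact: is_diff_phi.
have s j k := smooth_mul Uo (smooth_coord j Uo)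
  (smooth_const ((delta_mx 0 i : 'rV_3) 0 k) Uo).
have iq := smooth_inv_radial Uo UA.
have := smooth_mul Uo (smooth_add Uo (s 0 1) (smooth_opp Uo (s 1 0)))
  (smooth_mul Uo iq iq).
by apply: smooth_ext => // y _; rewrite /dphi -invfM.
Qed.
End PolarAngle.

Lemma polar_angle_exists r : off_axis3 r ->
  exists p : R, r 0 0 = q r * cos p /\ r 0 1 = q r * sin p.
Proof.
move=> hr; have q0 : q r != 0 by rewrite gt_eqF.
pose c := r 0 0 / q r.
have c1 : -1 <= c <= 1.
  rewrite -ler_norml -(@ler_pXn2r _ 2) ?nnegrE// expr1n -normrX ger0_norm ?sqr_ge0//.
  by rewrite expr_div_n ler_pdivrMr ?exprn_gt0// mul1r radial_sqr lerDl sqr_ge0.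
have cE : cos (acos c) = c by rewrite acosK// in_itv.
have sE : sin (acos c) = `|r 0 1| / q r.
  rewrite sin_acos// -(gtr0_norm (x := q r))// -normrV ?unitfE// -normrM -sqrtr_sqr.
  congr Num.sqrt; rewrite !expr_div_n -[1](divff (expf_neq0 2 q0)) -mulrBl.
  by rewrite [in X in X - _]radial_sqr addrC addKr.
have [r1|r1] := leP 0 (r 0 1).
  exists (acos c); rewrite cE sE /c ger0_norm//.
  by split; rewrite mulrC divfK.
exists (- acos c); rewrite cosN sinN cE sE /c ltr0_norm//.
by split; [|rewrite mulNr opprK]; rewrite mulrC divfK.
Qed.

(** If p is a polar angle of r, then p + asin (sin (phi - p)) is a branch on the half
space where cos (phi - p) > 0; co and si below are q times the cosine and sine of
phi - p. *)
Lemma polar_branch_exists r : off_axis3 r ->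
  exists (U : set 'rV[R]_3) (phi : 'rV[R]_3 -> R),
    [/\ U r, open U, U `<=` off_axis3,
        (forall y, U y -> {for y, continuous phi}) &
        forall y, U y -> y 0 0 = q y * cos (phi y) /\ y 0 1 = q y * sin (phi y)].
Proof.
move=> hr; have [p [r0 r1]] := polar_angle_exists hr.
pose co y := cos p * y 0 0 + sin p * y 0 1.
pose si y := cos p * y 0 1 + - sin p * y 0 0.
have cs := cos2Dsin2 p.
have D (u v : R) i j y : is_diff y (fun z : 'rV[R]_3 => u * z 0 i + v * z 0 j) _ :=
  is_diff_add (is_diff_scale u (is_diff_coord i y)) (is_diff_scale v (is_diff_coord j y)).
have cosi y : co y ^+ 2 + si y ^+ 2 = q y ^+ 2.
  rewrite radial_sqr /co /si -[RHS]mul1r -cs; ring.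
pose U := off_axis3 `&` [set y | 0 < co y].
have co_open : open [set y | 0 < co y].
  have -> : [set y | 0 < co y] = co @^-1` [set t | 0 < t] by [].
  apply: open_comp; last exact: open_gt.
  by move=> y _; apply: differentiable_continuous; case: (D (cos p) (sin p) 0 1 y).
have s1 y : U y -> -1 < si y / q y < 1.
  move=> [hy coy]; rewrite -ltr_norml -(@ltr_pXn2r _ 2) ?nnegrE// expr1n -normrX ger0_norm ?sqr_ge0//.
  by rewrite expr_div_n ltr_pdivrMr ?exprn_gt0// mul1r -cosi ltrDr exprn_gt0.
exists U, (fun y => p + asin (si y / q y)); split.
- by split=> //; rewrite /= /co r0 r1 mulrCA [sin p * _]mulrCA -mulrDr -!expr2 cs mulr1.
- by apply: openI => //; exact: open_off_axis3.
- by move=> y [].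
- move=> y Uy; have hy : off_axis3 y by case: Uy.
  have q0 : q y != 0 by rewrite gt_eqF.
  have sD := is_diff_mul (D (cos p) (- sin p) 1 0 y)
    (is_diff_chain (is_diff_radial hy) (is_derive_inv q0)).
  have [aD _] := is_diff_add (is_diff_const p y) (is_diff_chain sD (is_derive1_asin (s1 _ Uy))).
  exact: differentiable_continuous aD.
- move=> y Uy; have [hy coy] := Uy; have q0 : q y != 0 by rewrite gt_eqF.
  have /andP[/ltW l1 /ltW l2] := s1 _ Uy; have l12 : -1 <= si y / q y <= 1 by rewrite l1.
  have cE : cos (asin (si y / q y)) = co y / q y.
    rewrite cos_asin// -[RHS]ger0_norm; last by rewrite divr_ge0 ?ltW.
    rewrite -sqrtr_sqr; congr Num.sqrt; rewrite !expr_div_n.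
    by rewrite -[1](divff (expf_neq0 2 q0)) -mulrBl -[in X in X - _]cosi addrK.
  have sE : sin (asin (si y / q y)) = si y / q y by rewrite asinK// in_itv.
  rewrite cosD sinD cE sE; split.
    transitivity ((cos p ^+ 2 + sin p ^+ 2) * y 0 0); first by rewrite cs mul1r.
    by rewrite /co /si; field.
  transitivity ((cos p ^+ 2 + sin p ^+ 2) * y 0 1); first by rewrite cs mul1r.
  by rewrite /co /si; field.
Qed.

End Model.

(** * The metric tensor in the frame *)

Lemma half_hessK2_mx (R : realType) (g : R) (r v w : 'rV[R]_3) :
  half_hessK2 g r v w =
  (v *m (\matrix_(i, j) half_hessK2 g r (delta_mx 0 i) (delta_mx 0 j)) *m w^T) 0 0.
Proof.
move: v w; apply: bilinear_mx => w k u u'.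
  by rewrite /half_hessK2 /dchi /dradial /axial !mxE; ring.
by rewrite /half_hessK2 /dchi /dradial /axial !mxE; ring.
Qed.

Section FrameComponents.
Set Implicit Arguments.
Unset Strict Implicit.
Context (R : realType) (S : FFPD_space R 3) (x : mpoint S) (e : 'M[R]_3)
  (he : adapted_frame x e).
Implicit Types r v w y : 'rV[R]_3.

Local Notation g := (charge_g x).
Local Notation a := (metric_a x).

Let hg : -2 < g < 2. Proof. exact: charge_g_range. Qed.

Lemma frame_unit : e \in unitmx.
Proof. by case: he => /mulmx1_unit[]; rewrite unitmx_mul => /andP[]. Qed.

Lemma metric_unit : a \in unitmx.
Proof. by case: he => /mulmx1_unit[]; rewrite unitmx_mul => /andP[]. Qed.

(** b_i is the a-dual of the third frame vector, and the frame is a-orthonormal. *)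
Lemma form_b_frame : e *m (form_b x)^T = (delta_mx 0 ord_max)^T.
Proof.
have [eae eb] := he.
have bE : (form_b x)^T = a *m (b_up x)^T.
  rewrite -[LHS]mul1mx -(mulmxV metric_unit) -mulmxA; congr (_ *m _).
  apply/colP => i; rewrite !mxE; apply: eq_bigr => j _.
  by rewrite mxE.
by rewrite bE -eb rowE trmx_mul !mulmxA eae mul1mx.
Qed.

Lemma fb_frame r : fb x (r *m e) = axial r.
Proof.
have -> : fb x (r *m e) = ((r *m e) *m (form_b x)^T) 0 0.
  by rewrite mxE; apply: eq_bigr => i _; rewrite [X in _ = _ * X]mxE mulrC.
by rewrite -mulmxA form_b_frame trmx_delta -colE mxE.
Qed.

Lemma fq_frame r : fq x (r *m e) = radial r.
Proof.
have [eae _] := he; rewrite /fq /radial; congr Num.sqrt.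
set y := r *m e.
transitivity ((y *m a *m y^T) 0 0 - fb x y ^+ 2).
  rewrite expr2 /fb big_distrlr/= mxE exchange_big -sumrB.
  apply: eq_bigr => m _; rewrite !mxE mulr_suml -sumrB.
  by apply: eq_bigr => n _; ring.
have -> : y *m a *m y^T = r *m r^T.
  by rewrite /y trmx_mul !mulmxA -[r *m e *m a]mulmxA -[r *m (e *m a) *m e^T]mulmxA eae mulmx1.
rewrite fb_frame mxE !big_ord_recr big_ord0 /= !mxE add0r /axial.
rewrite -!expr2 -[X in r 0 X ^+ 2 + _ + _](_ : 0 = _); last exact: val_inj.
by rewrite addrK; congr (_ + r 0 _ ^+ 2); apply: val_inj.
Qed.

Lemma frameK_model : frameK x e = modelK g.
Proof.
apply/funext => r; rewrite /frameK /fK /fchi /ff /fA /fB fb_frame fq_frame.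
by [].
Qed.

Lemma frame_chi_model : frame_chi x e = model_chi g.
Proof.
apply/funext => r; rewrite /frame_chi /fchi /ff /fA /fB fb_frame fq_frame.
by [].
Qed.

Lemma off_axis_model : off_axis x e = @off_axis3 R.
Proof. by apply/funext => r; rewrite /off_axis /off_axis3/= fq_frame. Qed.

(** Both differentiations of the metric tensor are along basis vectors of T_xM; in the
frame they become derivatives along the rows of e^-1, which the congruence with e
undoes. *)
Lemma frame_metricE r : off_axis3 r ->
  frame_metric x e r = \matrix_(i, j) half_hessK2 g r (delta_mx 0 i) (delta_mx 0 j).
Proof.
move=> hr; set H := \matrix_(i, j) _.
rewrite /frame_metric; have -> : metric_tensor x (r *m e) = invmx e *m H *m (invmx e)^T.
  apply/matrixP => i j; rewrite mxE.
  have KE : (fun y => fK x y ^+ 2) = (fun y => modelK g (y *m invmx e) ^+ 2).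
    by apply/funext => y; rewrite -frameK_model /frameK mulmxKV// frame_unit.
  have -> : partial j (fun y => fK x y ^+ 2) =
      (fun y => 'D_(delta_mx 0 j *m invmx e) (fun s => modelK g s ^+ 2) (y *m invmx e)).
    apply/funext => y; rewrite /partial KE.
    exact: (derive_mulmx (fun s => modelK g s ^+ 2)).
  pose D2 v := 'D_v (fun s => modelK g s ^+ 2) : 'rV[R]_3 -> R.
  rewrite /partial (derive_mulmx (D2 _)) mulmxK ?frame_unit// /D2.
  set vi := delta_mx 0 i *m _; set vj := delta_mx 0 j *m _.
  have K2D t : off_axis3 t ->
      'D_vj (fun s => modelK g s ^+ 2) t = 2 * half_dK2 g t vj.
    by move=> ht; have [D DE] := is_diff_modelK_sqr hg ht; rewrite deriveE// DE.
  have near_dK : \forall t \near r,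
      2 * half_dK2 g t vj = 'D_vj (fun s => modelK g s ^+ 2) t.
    apply: filterS (open_nbhs_nbhs (conj (@open_off_axis3 R) hr)) => t ht.
    by rewrite K2D.
  rewrite -(near_eq_derive _ near_dK).
  have [D DE] := is_diff_scale 2 (is_diff_half_dK2 hg hr vj).
  rewrite deriveE// DE mulKf// (half_hessK2_mx g r) -/H.
  have -> (M : 'M[R]_3) : M i j =
      ((delta_mx 0 i : 'rV_3) *m M *m (delta_mx 0 j : 'rV_3)^T) 0 0.
    by rewrite -rowE trmx_delta -colE !mxE.
  by rewrite /vi /vj trmx_mul !mulmxA.
rewrite !mulmxA mulmxV ?frame_unit// mul1mx -mulmxA -trmx_mul.
by rewrite mulmxV ?frame_unit// trmx1 mulmx1.
Qed.

Lemma ds2E r v : off_axis3 r -> ds2 x e r v = half_hessK2 g r v v.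
Proof. by move=> hr; rewrite /ds2 frame_metricE// -half_hessK2_mx.
Qed.
End FrameComponents.

(** * The Finsleroid coordinates *)

Section Coordinates.
Set Implicit Arguments.
Unset Strict Implicit.
Context (R : realType) (S : FFPD_space R 3) (x : mpoint S) (e : 'M[R]_3)
  (he : adapted_frame x e).
Implicit Types (r v : 'rV[R]_3) (k : 'I_3).

Local Notation g := (charge_g x).
Let hg : -2 < g < 2. Proof. exact: charge_g_range. Qed.

Section Branch.
Context (U : set 'rV[R]_3) (phi : 'rV[R]_3 -> R)
  (hphi : polar_angle_on x e U phi).

Let Uo : open U. Proof. by case: hphi. Qed.
Let UA : U `<=` @off_axis3 R.
Proof. by case: hphi => _ + _ _; rewrite off_axis_model. Qed.
Let phiC r : U r -> {for r, continuous phi}.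
Proof. by case: hphi => _ _ + _; apply. Qed.
Let phiE r : U r ->
  r 0 0 = radial r * cos (phi r) /\ r 0 1 = radial r * sin (phi r).
Proof. by case: hphi => _ _ _ + Ur => /(_ _ Ur); rewrite (fq_frame he). Qed.

Definition dcoord r k v : R :=
  nth 0 [:: modelK g r * dlogK g r v; dphi r v; dchi g r v] k.

Lemma finsleroid_coordE k : finsleroid_coord x e phi k =
  nth (modelK g) [:: modelK g; phi; model_chi g] k.
Proof. by rewrite /finsleroid_coord (frameK_model he) (frame_chi_model he). Qed.

Lemma is_diff_finsleroid_coord r k : U r ->
  is_diff r (finsleroid_coord x e phi k) (dcoord r k).
Proof.
move=> Ur; have hr := UA Ur; rewrite finsleroid_coordE.
case: k => [[|[|[|//]]] i]; rewrite /dcoord /=.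
- exact: is_diff_modelK.
- exact: (is_diff_phi Uo UA phiC phiE).
- exact: is_diff_chi.
Qed.

Lemma finsleroid_coordinates : coordinates_on U (finsleroid_coord x e phi).
Proof.
split=> [k|r s Ur Us zrs|r Ur].
- rewrite finsleroid_coordE; case: k => [[|[|[|//]]] i] /=.
  + exact: smooth_modelK.
  + exact: (smooth_phi Uo UA phiC phiE).
  + exact: smooth_chi.
- have := zrs 0; have := zrs 1; have := zrs ord_max.
  rewrite !finsleroid_coordE /= => cE pE KE.
  have [bE qE] := axial_radial_inj hg (UA Ur) (UA Us) KE cE.
  have [r0 r1] := phiE Ur; have [s0 s1] := phiE Us.
  apply: rV3_eq => //; first by rewrite r0 s0 qE pE.
  by rewrite r1 s1 qE pE.
- apply: unit_jacobian => [k|v dz0]; first exact: is_diff_finsleroid_coord.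
  have hr := UA Ur; apply: (polar_diff_inj hg hr).
  + have /eqP := dz0 0; rewrite /dcoord /= mulf_eq0 gt_eqF ?modelK_gt0//=.
    by move/eqP.
  + exact: (dz0 ord_max).
  + exact: (dz0 1).
Qed.

Lemma diff_finsleroid_coord r k v : U r ->
  'd (finsleroid_coord x e phi k) r v = dcoord r k v.
Proof. by move=> Ur; have [_ ->] := is_diff_finsleroid_coord k Ur. Qed.

Lemma finsleroid_metric_diag r v : U r ->
  ds2 x e r v = dcoord r 0 v ^+ 2 + modelK g r ^+ 2 * (dcoord r ord_max v ^+ 2 +
    (hpar x ^+ 2)^-1 * sin (hpar x * model_chi g r) ^+ 2 * dcoord r 1 v ^+ 2).
Proof.
move=> Ur; have hr := UA Ur; rewrite (ds2E he _ hr) (half_hessK2_diag hg hr).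
rewrite /dcoord /=.
have -> : hpar x = charge_h g by [].
have h0 := lt0r_neq0 (charge_h_gt0 hg).
have B0 := modelB_gt0 hg hr.
rewrite [(modelK g r * _) ^+ 2]exprMn (modelK_sqr hg hr).
have -> : sin (charge_h g * model_chi g r) ^+ 2 =
    charge_h g ^+ 2 * radial r ^+ 2 / modelB g r.
  by rewrite (sin_chi hg hr) expr_div_n exprMn (sqr_sqrtr (ltW B0)).
by field; rewrite h0 lt0r_neq0.
Qed.

Lemma spherical_coord r : g = 0 -> U r ->
  [/\ r 0 0 = modelK g r * sin (model_chi g r) * cos (phi r),
      r 0 1 = modelK g r * sin (model_chi g r) * sin (phi r)
    & r 0 ord_max = modelK g r * cos (model_chi g r)].
Proof.
move=> g0 Ur; have hr := UA Ur; have [r0 r1] := phiE Ur.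
have h1 : charge_h g = 1 by rewrite /charge_h g0 expr0n mul0r subr0 sqrtr1.
have KE : modelK g r = Num.sqrt (modelB g r).
  by rewrite sqrtB_modelK g0 mulr0 mul0r expR0 mulr1.
have qE : modelK g r * sin (model_chi g r) = radial r.
  by have := radial_chi hg hr; rewrite h1 !mul1r KE.
have AE : modelK g r * cos (model_chi g r) = axial r.
  have := modelA_chi hg hr; rewrite h1 mul1r KE => <-.
  by rewrite /modelA g0 mulr0 mul0r addr0.
by rewrite qE AE.
Qed.
End Branch.

(** A vector on which all d Phi^k vanish is isotropic for the metric, which is
definite. *)
Lemma flat_coordinates : coordinates_on (off_axis x e) (flat_coord g).
Proof.
rewrite (off_axis_model he); have Ao := @open_off_axis3 R.
split=> [k|r s hr hs|r hr].
- exact: smooth_flat_coord.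
- exact: flat_coord_inj.
- apply: unit_jacobian => [k|v dz0]; first exact: is_diff_flat.
  have H0 : half_hessK2 g r v v = 0.
    have := half_hessK2_flat hg hr v v; rewrite big1 ?mulr0 => [/eqP|k _].
      rewrite mulf_eq0 mulf_eq0 !sqrf_eq0.
      by rewrite gt_eqF ?charge_h_gt0// gt_eqF ?expR_gt0//= => /eqP.
    by rewrite dz0 mulr0.
  by have [] := half_hessK2_eq0 hg hr H0; exact: polar_diff_inj.
Qed.

Lemma frame_metric_conformal r : off_axis x e r ->
  frame_metric x e r = varkappa x e r ^+ 2 *:
    \matrix_(i, j) \sum_k partial i (flat_coord g k) r * partial j (flat_coord g k) r.
Proof.
rewrite (off_axis_model he) => hr; rewrite (frame_metricE he hr).
apply/matrixP => i j; rewrite !mxE /varkappa (frameK_model he).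
have -> : hpar x = charge_h g by [].
have hW0 : charge_h g ^+ 2 * modelW g r ^+ 2 != 0.
  by rewrite mulf_neq0// expf_neq0// lt0r_neq0 ?charge_h_gt0 ?expR_gt0.
apply: (mulfI hW0); rewrite (half_hessK2_flat hg hr) mulrA [_ * _ * _ ^+ 2]mulrC.
rewrite (conformal_factor_sqr hg hr); congr (_ * _); apply: eq_bigr => k _.
by rewrite !(partial_is_diff _ (is_diff_flat hg hr k)).
Qed.
End Coordinates.

Theorem mainTheorem11 (R : realType) (S : FFPD_space R 3) (x : mpoint S)
    (e : 'M[R]_3) (he : adapted_frame x e) :
  (* local branches of the polar angle exist around every off-axis point *)
  (forall r, off_axis x e r ->
     exists (U : set 'rV[R]_3) (phi : 'rV[R]_3 -> R),
       U r /\ polar_angle_on x e U phi) /\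
  (forall (U : set 'rV[R]_3) (phi : 'rV[R]_3 -> R),
     polar_angle_on x e U phi ->
     let z := finsleroid_coord x e phi in
     let z1 := z 0 in let z2 := z 1 in let z3 := z ord_max in
     let h := hpar x in
     [/\ (* z is a system of coordinates on U *)
         coordinates_on U z,
         (* diagonal representation of the metric *)
         forall r v : 'rV[R]_3, U r ->
           ds2 x e r v =
             ('d z1 r v) ^+ 2 +
             z1 r ^+ 2 * (('d z3 r v) ^+ 2 +
               (h ^+ 2)^-1 * sin (h * z3 r) ^+ 2 * ('d z2 r v) ^+ 2),
         (* induced metric on the indicatrix, v being tangent to K = 1 *)
         forall r v : 'rV[R]_3, U r -> frameK x e r = 1 ->
           'd (frameK x e) r v = 0 ->
           ds2 x e r v =
             ('d z3 r v) ^+ 2 +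
             (h ^+ 2)^-1 * sin (h * z3 r) ^+ 2 * ('d z2 r v) ^+ 2
       & (* for g = 0 the coordinates are the spherical ones *)
         charge_g x = 0 -> forall r : 'rV[R]_3, U r ->
           [/\ r 0 0 = z1 r * sin (z3 r) * cos (z2 r),
               r 0 1 = z1 r * sin (z3 r) * sin (z2 r)
             & r 0 ord_max = z1 r * cos (z3 r)]]) /\
  (* conformal flatness *)
  (exists2 E : 'rV[R]_3 -> 'M[R]_3,
     euclidean_metric_on (off_axis x e) E &
     forall r, off_axis x e r ->
       frame_metric x e r = varkappa x e r ^+ 2 *: E r).
Proof.
have hg := charge_g_range x; split; last split.
- move=> r; rewrite (off_axis_model he) => hr.
  have [U [phi [Ur Uo UA phiC phiE]]] := polar_branch_exists hr.
  exists U, phi; split=> //; split=> //; first by rewrite (off_axis_model he).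
  by move=> y Uy; rewrite (fq_frame he); exact: phiE.
- move=> U phi hphi z z1 z2 z3 h.
  have dE k r v := diff_finsleroid_coord he hphi (r := r) k v.
  have z1E : z1 = modelK (charge_g x) by exact: (frameK_model he).
  have z3E : z3 = model_chi (charge_g x) by exact: (frame_chi_model he).
  have diag r v : U r -> ds2 x e r v =
      ('d z1 r v) ^+ 2 + z1 r ^+ 2 * (('d z3 r v) ^+ 2 +
        (h ^+ 2)^-1 * sin (h * z3 r) ^+ 2 * ('d z2 r v) ^+ 2).
    move=> Ur; have d1 : 'd z1 r v = _ := dE 0 r v Ur.
    have d2 : 'd z2 r v = _ := dE 1 r v Ur.
    have d3 : 'd z3 r v = _ := dE ord_max r v Ur.
    rewrite d1 d2 d3 z1E z3E; exact: (finsleroid_metric_diag he hphi).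
  split=> //.
  + exact: finsleroid_coordinates.
  + move=> r v Ur K1 dK0; rewrite (diag _ _ Ur).
    have -> : 'd z1 r v = 0 by [].
    have -> : z1 r = 1 by [].
    by rewrite expr0n add0r expr1n mul1r.
  + move=> g0 r Ur; rewrite z1E z3E.
    exact: (spherical_coord he hphi g0 Ur).
- exists (fun r => \matrix_(i, j) \sum_k
    partial i (flat_coord (charge_g x) k) r * partial j (flat_coord (charge_g x) k) r).
    by exists (flat_coord (charge_g x)) => //; exact: flat_coordinates.
  by move=> r hr; exact: (frame_metric_conformal he).
Qed.
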